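(* Let $m,n\ge 1$. For $i=1,\ldots,m$ let $f_i:\mathbb{R}^n\to\mathbb{R}$ be convex and let $h_i:\mathbb{R}^n\to\mathbb{R}$ be convex and differentiable with $\nabla h_i$ Lipschitz continuous with constant $L_i>0$; put $F_i:=f_i+h_i$ and $F:=\sum_{i=1}^m F_i$. Let $g:\mathbb{R}^n\to\mathbb{R}$ be convex and differentiable with $\nabla g$ Lipschitz continuous with constant $L_g>0$, and assume $\min g=0$. Let $\mathcal{S}$ be the solution set of the problem $\min\{F(x): x\in\arg\min g\}$, and assume $\mathcal{S}\neq\emptyset$. Let $(\alpha_k)_{k\ge1}$, $(\beta_k)_{k\ge1}$ be positive sequences, $x_1\in\mathbb{R}^n$ arbitrary, and for $k\ge1$ define $$\varphi_{1,k}:=x_k-\alpha_k\beta_k\nabla g(x_k),\qquad \varphi_{i+1,k}:=\operatorname{prox}_{\alpha_k f_i}\big(\varphi_{i,k}-\alpha_k\nabla h_i(\varphi_{i,k})\big)\ (i=1,\ldots,m),\qquad x_{k+1}:=\varphi_{m+1,k}.$$ Assume: (H1) $\partial\big(\sum_{i=1}^m f_i+\delta_{\arg\min g}\big)=\sum_{i=1}^m\partial f_i+N_{\arg\min g}$; (H2) $\sum_{k=1}^\infty\alpha_k=+\infty$ and $\sum_{k=1}^\infty\alpha_k^2<+\infty$; (H3) $0<\liminf_{k\to\infty}\alpha_k\beta_k\le\limsup_{k\to\infty}\alpha_k\beta_k<\frac{2}{L_g}$; (H4) for every $p\in\operatorname{ran}(N_{\arg\min g})$, $\sum_{k=1}^\infty\alpha_k\beta_k\Big[g^*\big(\tfrac{p}{\beta_k}\big)-\sigma_{\arg\min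 g}\big(\tfrac{p}{\beta_k}\big)\Big]<+\infty$. Then the sequence $(x_k)_{k\ge1}$ converges to a point in $\mathcal{S}$.
   Context: For $r>0$ and convex $f:\mathbb{R}^n\to\mathbb{R}$, $\operatorname{prox}_{rf}(x)$ is the unique minimizer of $u\mapsto f(u)+\frac{1}{2r}\|u-x\|^2$. $g^*(u)=\sup_x\{\langle u,x\rangle-g(x)\}$ is the Fenchel conjugate. For a nonempty set $X$, $\delta_X$ is its indicator function ($0$ on $X$, $+\infty$ otherwise), $N_X(x)=\{u:\langle u,y-x\rangle\le0\ \forall y\in X\}$ for $x\in X$ (empty otherwise) is the normal cone, $\operatorname{ran}(N_X)=\bigcup_{x\in X}N_X(x)$, and $\sigma_X(u)=\sup_{y\in X}\langle y,u\rangle$ is the support function. $\partial$ denotes the convex subdifferential. *)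

(* Defs.v *)
(* MathComp + MathComp-Analysis, over an abstract R : realType.
   Vectors of R^n are row vectors 'rV[R]_n. The library norm on 'rV is the
   max-norm, so the Euclidean inner product / norm are defined here. *)
From HB Require Import structures.
From mathcomp Require Import all_boot all_order all_algebra.
From mathcomp Require Import all_classical all_reals all_analysis.
Set Implicit Arguments. Unset Strict Implicit. Unset Printing Implicit Defensive.
Import Order.TTheory GRing.Theory Num.Theory.
Import numFieldNormedType.Exports.
Local Open Scope classical_set_scope.
Local Open Scope ring_scope.

Section Defs.
Variables (R : realType) (n : nat).
Notation vec := 'rV[R]_n.

Definition dotv (u v : vec) : R := \sum_(j < n) u ord0 j * v ord0 j.
Definition enorm (u : vec) : R := Num.sqrt (dotv u u).

Definition convex_fun (f : vec -> R) : Prop :=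
  forall (x y : vec) (t : R), 0 <= t <= 1 ->
    f (t *: x + (1 - t) *: y) <= t * f x + (1 - t) * f y.

Definition is_gradient (f : vec -> R) (G : vec -> vec) : Prop :=
  forall x : vec, differentiable f x /\ forall v : vec, 'd f x v = dotv (G x) v.

Definition lipschitz_with (G : vec -> vec) (L : R) : Prop :=
  forall x y : vec, enorm (G x - G y) <= L * enorm (x - y).

Definition prox_obj (r : R) (f : vec -> R) (x u : vec) : R :=
  f u + (2 * r)^-1 * (enorm (u - x)) ^+ 2.
Definition prox (r : R) (f : vec -> R) (x : vec) : vec :=
  xget 0 [set p | forall u, prox_obj r f x p <= prox_obj r f x u].

Definition argmin (g : vec -> R) : set vec := [set x | forall y, g x <= g y].

Definition delta_set (X : set vec) (x : vec) : \bar R :=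
  if `[< X x >] then 0%E else +oo%E.

Definition subdiffE (phi : vec -> \bar R) (x : vec) : set vec :=
  [set u | phi x \is a fin_num /\
           forall y, (phi x + (dotv u (y - x))%:E <= phi y)%E].
Definition subdiff (f : vec -> R) (x : vec) : set vec :=
  subdiffE (fun y => (f y)%:E) x.

Definition normal_cone (X : set vec) (x : vec) : set vec :=
  [set u | X x /\ forall y, X y -> dotv u (y - x) <= 0].
Definition ran_normal_cone (X : set vec) : set vec :=
  [set u | exists x, normal_cone X x u].
Definition support_fun (X : set vec) (u : vec) : \bar R :=
  ereal_sup [set (dotv y u)%:E | y in X].
Definition conjugate (g : vec -> R) (u : vec) : \bar R :=
  ereal_sup [set (dotv u x - g x)%:E | x in [set: vec]].

(* The iteration. Indices of f_i, h_i are 0-based (i < m); the iteration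
   index k is 0-based (xseq 0 = x_1). *)
Fixpoint phi_it (f h : nat -> vec -> R) (gh : nat -> vec -> vec)
   (gg : vec -> vec) (a b : R) (x : vec) (i : nat) : vec :=
  match i with
  | 0 => x - (a * b) *: gg x
  | i'.+1 =>
      let p := phi_it f h gh gg a b x i' in
      prox a (f i') (p - a *: gh i' p)
  end.

Fixpoint xseq (m : nat) (f h : nat -> vec -> R) (gh : nat -> vec -> vec)
   (gg : vec -> vec) (alpha beta : nat -> R) (x1 : vec) (k : nat) : vec :=
  match k with
  | 0 => x1
  | k'.+1 => phi_it f h gh gg (alpha k') (beta k')
               (xseq m f h gh gg alpha beta x1 k') m
  end.

End Defs.

(* Main.v *)
(* Write [F_i = f_i + h_i].  A minimizer [u] has multipliers [w_i] in the
   subdifferential of [F_i] at [u] and [p] in the normal cone of [argmin g] at [u]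
   with [sum w_i + p = 0].  The variational inequality of each prox step, the
   descent lemma for [h_i] and the cocoercivity of the gradient of [g] give
     |x_(k+1) - u|^2 + th c g(x_k) + D_k / 4 <= |x_k - u|^2 + e_k,
   where [D_k] is the sum of the squared increments of the inner loop and [e_k] is
   summable by (H2) and (H4).  Hence [x_k] is bounded, while [g(x_k)] and [D_k]
   tend to 0.  Without the multipliers the same estimates give
     2 alpha_k (sum_i F_i(phi_(i+1,k)) - F(u)) <= |x_k - u|^2 - |x_(k+1) - u|^2,
   so, as [sum alpha_k] diverges, some subsequence of [x_k] converges to a minimizer;
   the first inequality at that minimizer makes the whole sequence converge. *)

Require Import Defs.
From HB Require Import structures.
From mathcomp Require Import all_boot all_order all_algebra.
From mathcomp Require Import all_classical all_reals all_analysis.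
From mathcomp Require Import ring lra.
Import Order.TTheory GRing.Theory Num.Theory.
Import numFieldNormedType.Exports.
Local Open Scope classical_set_scope.
Local Open Scope ring_scope.

Set Implicit Arguments.
Unset Strict Implicit.
Unset Printing Implicit Defensive.

(** * Euclidean inner product on row vectors and its comparison with the max-norm *)

Section Euclidean.
Variables (R : realType) (n : nat).
Implicit Types (u v w x y d : 'rV[R]_n) (a t : R).

Lemma dotvC u v : dotv u v = dotv v u.
Proof. by apply: eq_bigr => j _; rewrite mulrC. Qed.

Lemma dotvDl u v w : dotv (u + v) w = dotv u w + dotv v w.
Proof. by rewrite /dotv -big_split; apply: eq_bigr => j _; rewrite mxE mulrDl. Qed.

Lemma dotvDr u v w : dotv w (u + v) = dotv w u + dotv w v.
Proof. by rewrite dotvC dotvDl !(dotvC w). Qed.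

Lemma dotvZl a u v : dotv (a *: u) v = a * dotv u v.
Proof. by rewrite /dotv mulr_sumr; apply: eq_bigr => j _; rewrite mxE mulrA. Qed.

Lemma dotvZr a u v : dotv u (a *: v) = a * dotv u v.
Proof. by rewrite dotvC dotvZl dotvC. Qed.

Lemma dotvNl u v : dotv (- u) v = - dotv u v.
Proof. by rewrite -scaleN1r dotvZl mulN1r. Qed.

Lemma dotvNr u v : dotv u (- v) = - dotv u v.
Proof. by rewrite dotvC dotvNl dotvC. Qed.

Lemma dot0v u : dotv 0 u = 0.
Proof. by rewrite -(scale0r 0) dotvZl mul0r. Qed.

Definition dotvE := (dotvDl, dotvDr, dotvNl, dotvNr, dotvZl, dotvZr).

Lemma dotv_suml (m : nat) (w : nat -> 'rV[R]_n) v :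
  dotv (\sum_(i < m) w i) v = \sum_(i < m) dotv (w i) v.
Proof.
elim: m => [|m IH]; first by rewrite !big_ord0 dot0v.
by rewrite !big_ord_recr /= dotvDl IH.
Qed.

Lemma dotvv_ge0 u : 0 <= dotv u u.
Proof. by apply: sumr_ge0 => j _; rewrite -expr2 sqr_ge0. Qed.

Lemma sqr_enorm u : enorm u ^+ 2 = dotv u u.
Proof. by rewrite sqr_sqrtr ?dotvv_ge0. Qed.

Lemma enorm_ge0 u : 0 <= enorm u.
Proof. exact: sqrtr_ge0. Qed.

Lemma coord_le_enorm u j : `|u ord0 j| <= enorm u.
Proof.
rewrite -sqrtr_sqr ler_sqrt ?dotvv_ge0// /dotv (bigD1 j) //= -expr2 lerDl.
by apply: sumr_ge0 => i _; rewrite -expr2 sqr_ge0.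
Qed.

Lemma enorm_eq0 u : enorm u = 0 -> u = 0.
Proof.
move=> u0; apply/rowP => j; rewrite mxE; apply/eqP.
by rewrite -normr_le0 -u0 coord_le_enorm.
Qed.

(** The defect is [t^-1 |t u - v|^2]. The free weight [t] decides which square pays for a cross
    term. *)
Lemma dotv_young t u v : 0 < t -> 2 * dotv u v <= t * dotv u u + t^-1 * dotv v v.
Proof.
move=> t0.
have -> : t * dotv u u + t^-1 * dotv v v =
    2 * dotv u v + t^-1 * dotv (t *: u - v) (t *: u - v).
  by rewrite !dotvE (dotvC v u); field; rewrite gt_eqF.
by rewrite lerDl mulr_ge0 ?invr_ge0 ?dotvv_ge0// ltW.
Qed.

Lemma enormD_lt u v (e : R) : 0 < e -> enorm u < e -> enorm v < e ->
  enorm (u + v) < 2 * e.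
Proof.
move=> e0 ue ve; rewrite -(ltr_pXn2r (_ : 0 < 2)%N)// ?nnegrE ?enorm_ge0//; last first.
  by rewrite mulr_ge0// ltW.
have : enorm u ^+ 2 < e ^+ 2 by rewrite ltr_pXn2r// ?nnegrE ?enorm_ge0// ltW.
have : enorm v ^+ 2 < e ^+ 2 by rewrite ltr_pXn2r// ?nnegrE ?enorm_ge0// ltW.
have := dotv_young u v ltr01; rewrite !sqr_enorm !dotvE (dotvC v u) exprMn invr1.
lra.
Qed.

Lemma norm_rV_le u t : 0 <= t -> (forall j, `|u ord0 j| <= t) -> `|u| <= t.
Proof.
move=> t0 ut; rewrite [`|u|]mx_normrE; apply/bigmax_leP; split=> // -[i j] _ /=.
by rewrite ord1.
Qed.

Lemma coord_le_norm u j : `|u ord0 j| <= `|u|.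
Proof. by rewrite [`|u|]mx_normrE (le_bigmax _ (fun ij => `|u ij.1 ij.2|) (ord0, j)). Qed.

Lemma norm_le_enorm u : `|u| <= enorm u.
Proof. by apply: norm_rV_le; [exact: enorm_ge0|exact: coord_le_enorm]. Qed.

Lemma enorm_le_norm u : enorm u ^+ 2 <= n%:R * `|u| ^+ 2.
Proof.
rewrite sqr_enorm /dotv; apply: (@le_trans _ _ (\sum_(j < n) `|u| ^+ 2)).
  by apply: ler_sum => j _; rewrite -expr2 -real_normK ?num_real// lerXn2r ?nnegrE// coord_le_norm.
by rewrite sumr_const card_ord mulr_natl.
Qed.

Lemma enorm_cvg (x : nat -> 'rV[R]_n) l :
  (fun k => dotv (x k - l) (x k - l)) @ \oo --> (0 : R) -> x @ \oo --> l.
Proof.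
move=> xl; apply/cvgrPdist_lt => e e0.
move/cvgrPdist_lt: xl => /(_ (e ^+ 2)) []; first by rewrite exprn_gt0.
move=> N _ HN; exists N => // k /HN /=; rewrite sub0r normrN.
rewrite ger0_norm ?dotvv_ge0// -sqr_enorm ltr_pXn2r ?nnegrE ?enorm_ge0 ?ltW// => H.
by rewrite distrC (le_lt_trans (norm_le_enorm _)).
Qed.

End Euclidean.

(** Closed max-norm balls are compact. The cluster point is recorded through close terms at
    arbitrarily late indices, so no subsequence has to be carried along. *)
Lemma bounded_rV_cluster (R : realType) (n : nat)
    (y : nat -> 'rV[R]_n) (u : 'rV[R]_n) (r : R) : (0 < n)%N ->
  (forall j, enorm (y j - u) <= r) ->
  exists l, forall (e : R) (J : nat), 0 < e -> exists2 j, (J <= j)%N & enorm (y j - l) < e.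
Proof.
case: n y u => // n' y u _ yr.
pose A := [set x : 'rV[R]_n'.+1 | `|u - x| <= r].
have cA : compact A.
  apply: bounded_closed_compact.
    exists (`|u| + r); split; first exact: num_real.
    move=> M HM x /= Ax; apply: (le_trans _ (ltW HM)).
    by rewrite -[x](subKr u) (le_trans (ler_normB _ _))// lerD2l.
  exact: closed_closed_ball_.
have yA : (y @ \oo) A.
  exists 0%N => // j _; rewrite /= /A /= distrC; exact: le_trans (norm_le_enorm _) (yr j).
have [l [_ cl]] := cA _ _ yA.
exists l => e J e0.
(* If the max-norm is [z < d], the squared Euclidean norm is at most [n'.+1 * z ^+ 2], which is
   below [(d * n'.+2) ^+ 2 = e ^+ 2]. *)
pose d : R := e / n'.+2%:R.
have n0 : (0 : R) < n'.+2%:R by rewrite ltr0n.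
have d0 : 0 < d by rewrite divr_gt0.
have [||x [/= [j Jj <-] Bx]] := cl (y @` [set j | (J <= j)%N]) (ball l d).
- by exists J => // j /= Jj; exists j.
- exact: nbhsx_ballx.
exists j => //.
rewrite -(ltr_pXn2r (_ : 0 < 2)%N)// ?nnegrE ?enorm_ge0 ?ltW//.
apply: (le_lt_trans (enorm_le_norm _)).
have : `|y j - l| < d by rewrite distrC; move: Bx; rewrite -ball_normE.
move: (normr_ge0 (y j - l)); set z := `|_|; move=> z0 zd.
have -> : e = d * n'.+2%:R by rewrite mulfVK// gt_eqF.
rewrite exprMn mulrC; apply: (@lt_le_trans _ _ (d ^+ 2 * n'.+2%:R)).
  apply: (@le_lt_trans _ _ (z ^+ 2 * n'.+2%:R)).
    by rewrite ler_wpM2l ?sqr_ge0// ler_nat.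
  by rewrite ltr_pM2r// ltr_pXn2r// ?nnegrE ltW.
by rewrite ler_wpM2l ?sqr_ge0// expr2 ler_peMr ?ler1n// ltW.
Qed.

(** * Convex functions *)

Section Convex.
Variables (R : realType) (n : nat).
Implicit Types (f g h : 'rV[R]_n -> R) (G : 'rV[R]_n -> 'rV[R]_n).
Implicit Types (u v x y d : 'rV[R]_n) (a r t : R).

Lemma le_of_eps (A B : R) : (forall e : R, 0 < e -> A <= B + e) -> A <= B.
Proof. by move=> H; apply/ler_addgt0Pr. Qed.

(** If [A < 0], then [t = - A / (|B| - A) / 2] gives [t * B < - A]. This replaces the limit [t -> 0]
    in first-order optimality arguments along a segment. *)
Lemma ge0_of_segment (A B : R) :
  (forall t, 0 < t <= 1 -> 0 <= A + t * B) -> 0 <= A.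
Proof.
move=> H; rewrite leNgt; apply/negP => A0.
have nB : 0 <= `|B| by [].
have t0 : 0 < - A / (`|B| - A) by rewrite divr_gt0//; lra.
have t1 : - A / (`|B| - A) <= 1 by rewrite ler_pdivrMr; lra.
have := H (- A / (`|B| - A) / 2).
suff : - A / (`|B| - A) / 2 * B < - A by move=> ? /(_ _); lra.
apply: (@le_lt_trans _ _ (- A / (`|B| - A) / 2 * `|B|)).
  by rewrite ler_wpM2l ?ler_norm//; lra.
have -> : - A / (`|B| - A) / 2 * `|B| = (- A) * (`|B| / (`|B| - A)) / 2 by ring.
have : `|B| / (`|B| - A) <= 1 by rewrite ler_pdivrMr; lra.
nra.
Qed.

Lemma convex_segment f x d t : convex_fun f -> 0 <= t <= 1 ->
  f (x + t *: d) <= f x + t * (f (x + d) - f x).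
Proof.
move=> cf t01; have := cf (x + d) x t t01.
have -> : t *: (x + d) + (1 - t) *: x = x + t *: d.
  by rewrite scalerDr scalerBl scale1r addrC addrA subrK.
lra.
Qed.

Lemma convex_funD f h : convex_fun f -> convex_fun h -> convex_fun (fun x => f x + h x).
Proof. by move=> cf ch x y t t01; have := cf x y t t01; have := ch x y t t01; lra. Qed.

Lemma convex_prox_obj r f x : 0 < r -> convex_fun f -> convex_fun (prox_obj r f x).
Proof.
move=> r0 cf; apply: convex_funD => // y z t t01; rewrite !sqr_enorm.
have r2 : 0 <= (2 * r)^-1 by rewrite invr_ge0; lra.
suff H : dotv (t *: y + (1 - t) *: z - x) (t *: y + (1 - t) *: z - x) <=
    t * dotv (y - x) (y - x) + (1 - t) * dotv (z - x) (z - x).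
  have := ler_wpM2l r2 H; lra.
rewrite -subr_ge0.
suff -> : t * dotv (y - x) (y - x) + (1 - t) * dotv (z - x) (z - x) -
    dotv (t *: y + (1 - t) *: z - x) (t *: y + (1 - t) *: z - x) =
    t * (1 - t) * dotv (y - z) (y - z).
  by rewrite !mulr_ge0 ?dotvv_ge0//; lra.
by rewrite !dotvE (dotvC z y) (dotvC x y) (dotvC x z); ring.
Qed.

(** The mean of [k + 2] points combines the mean of the first [k + 1] points, with weight
    [(k + 1) / (k + 2)], and the last point. *)
Lemma convex_mean f (k : nat) (y : nat -> 'rV[R]_n) : convex_fun f ->
  f (k.+1%:R^-1 *: \sum_(i < k.+1) y i) <= k.+1%:R^-1 * \sum_(i < k.+1) f (y i).
Proof.
move=> cf; elim: k => [|k IH].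
  by rewrite !big_ord1 invr1 scale1r mul1r.
set c : R := k.+1%:R; set c' : R := k.+2%:R.
have c0 : 0 < c by rewrite ltr0n.
have c'E : c' = c + 1 by rewrite /c' -natr1.
have c'0 : c' != 0 by rewrite gt_eqF// c'E; lra.
have cc' : 1 - c / c' = c'^-1.
  by apply: (mulIf c'0); rewrite mulrBl mulfVK// mulVf// mul1r c'E addrAC subrr add0r.
rewrite big_ord_recr [X in _ <= X * _]/= [X in _ <= _ * X]big_ord_recr /=.
have -> : c'^-1 *: (\sum_(i < k.+1) y i + y k.+1) =
   (c / c') *: (c^-1 *: \sum_(i < k.+1) y i) + (1 - c / c') *: y k.+1.
  rewrite scalerDr scalerA; congr (_ *: _ + _ *: _).
    by rewrite mulrAC mulfV ?mul1r// gt_eqF.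
  by rewrite cc'.
apply: (le_trans (cf _ _ _ _)).
  by rewrite divr_ge0 ?ler_pdivrMr ?c'E/=; lra.
have cc : 0 <= c / c' by rewrite divr_ge0 ?c'E; lra.
have := ler_wpM2l cc IH; rewrite -/c.
have -> : c / c' * (c^-1 * \sum_(i < k.+1) f (y i)) = c'^-1 * \sum_(i < k.+1) f (y i).
  by rewrite mulrA [c / c' * _]mulrAC mulfV ?mul1r// gt_eqF.
by rewrite cc' mulrDr => H; rewrite lerD2r.
Qed.

End Convex.

(* A convex function is bounded above near [x] by Jensen's inequality along the
   axes, and [x] lies between [y] and a point of that neighbourhood. *)
Lemma convex_linear_lower_bound (R : realType) (n : nat)
    (f : 'rV[R]_n -> R) (x : 'rV[R]_n) : (0 < n)%N -> convex_fun f ->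
  exists2 M : R, 0 <= M & forall y, f x - M * enorm (y - x) <= f y.
Proof.
case: n f x => // n' f x _ cf.
pose e j : 'rV[R]_n'.+1 := delta_mx 0 (inord j).
pose B : R := \sum_(j < n'.+1) (`|f (x + e j) - f x| + `|f (x - e j) - f x|).
have B0 : 0 <= B by apply: sumr_ge0 => j _; apply: addr_ge0.
pose N : R := n'.+1%:R.
have N0 : 0 < N by rewrite ltr0n.
have axis (j : 'I_n'.+1) (s : R) : `|s| <= 1 -> f (x + s *: e j) <= f x + B.
  move=> s1.
  have : `|f (x + e j) - f x| + `|f (x - e j) - f x| <= B.
    rewrite /B (bigD1 j)//= lerDl; apply: sumr_ge0 => i _; exact: addr_ge0.
  move: (ler_norm (f (x + e j) - f x)) (ler_norm (f (x - e j) - f x)).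
  move: (normr_ge0 (f (x + e j) - f x)) (normr_ge0 (f (x - e j) - f x)).
  move: s1; rewrite ler_norml => s1.
  have [s0|s0] := leP 0 s.
    have : 0 <= s <= 1 by lra.
    move=> /(convex_segment x (e j) cf); nra.
  have : 0 <= - s <= 1 by lra.
  move=> /(convex_segment x (- e j) cf); rewrite scalerN scaleNr opprK; nra.
have box (v : 'rV[R]_n'.+1) : (forall j, `|v ord0 j| <= N^-1) -> f (x + v) <= f x + B.
  move=> vN.
  (* [x + v] is the mean of [N] points, one on each axis through [x], at distance [N |v_j| <= 1]. *)
  have -> : x + v = N^-1 *: \sum_(j < n'.+1) (x + (N * v ord0 (inord j)) *: e j).
    rewrite big_split /= sumr_const card_ord scalerDr -scaler_nat scalerA mulVf ?gt_eqF// scale1r.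
    congr (_ + _); rewrite {1}[v]row_sum_delta scaler_sumr; apply: eq_bigr => j _.
    by rewrite scalerA mulKf ?gt_eqF// /e inord_val.
  apply: (le_trans (convex_mean n' (fun j => x + (N * v ord0 (inord j)) *: e j) cf)).
  rewrite mulrC ler_pdivrMr//.
  apply: (@le_trans _ _ (\sum_(j < n'.+1) (f x + B))); last first.
    by rewrite sumr_const card_ord mulr_natr.
  apply: ler_sum => j _; rewrite inord_val; apply: axis.
  by rewrite normrM gtr0_norm// mulrC -ler_pdivlMr// div1r; exact: vN.
exists (N * B); first by apply: mulr_ge0 => //; exact: ltW.
move=> y; have [r0|r0] := leP (enorm (y - x)) 0.
  have r00 : enorm (y - x) = 0 by apply/le_anti; rewrite r0 enorm_ge0.
  by rewrite r00 mulr0 subr0; move/enorm_eq0/eqP: r00; rewrite subr_eq0 => /eqP ->.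
set r := enorm (y - x) in r0 *.
have Nr : 0 < N * r by rewrite mulr_gt0.
(* The point [z] lies in the box, on the far side of [x] from [y]. Then [x = l y + (1 - l) z] with
   [l = 1 / (1 + N r)], and dividing the convexity inequality by [l] leaves the slope [N * B]. *)
have := box ((- (N * r)^-1) *: (y - x)) => /(_ _)/wrap[].
  move=> j; rewrite mxE normrM normrN [`|_^-1|]gtr0_norm ?invr_gt0// invfM -mulrA.
  by rewrite ler_piMr ?invr_ge0 ?(ltW N0)// ler_pdivrMl// mulr1 coord_le_enorm.
set z := x + _ => fz.
pose l := (1 + N * r)^-1.
have l0 : 0 < l by rewrite invr_gt0; lra.
have lE : l * (1 + N * r) = 1 by rewrite mulVf// gt_eqF//; lra.
have l1 : 1 - l = l * (N * r) by rewrite -lE; ring.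
have := cf y z l; have -> : l *: y + (1 - l) *: z = x.
  have -> : z = x - (N * r)^-1 *: (y - x) by rewrite /z scaleNr.
  rewrite l1.
  rewrite -scalerA scalerBr scalerA mulfV ?gt_eqF// scale1r -scalerDr.
  by rewrite opprB addrCA [y + _]addrC subrK -{2}[x]scale1r -scalerDl addrC scalerA lE scale1r.
move=> /(_ _)/wrap[]; first by rewrite ltW//=; nra.
rewrite l1 => H; rewrite -(ler_pM2l l0).
have := @ler_wpM2l _ (l * (N * r)) _ _ _ fz; move=> /(_ _)/wrap[].
  by rewrite mulr_ge0 ?ltW.
have : f x = l * (1 + N * r) * f x by rewrite lE mul1r.
lra.
Qed.

(** * Gradient inequalities and the proximal map *)

Section Smooth.
Variables (R : realType) (n : nat).
Implicit Types (f g h : 'rV[R]_n -> R) (G : 'rV[R]_n -> 'rV[R]_n).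
Implicit Types (u v x y d p : 'rV[R]_n) (a r t : R).

(** By convexity, the difference quotients along [y - x] with steps in (0, 1] are at most
    [f y - f x]; the directional derivative is their limit. *)
Lemma convex_gradient_le f G x y : convex_fun f -> is_gradient f G ->
  f x + dotv (G x) (y - x) <= f y.
Proof.
move=> cf fG; have [df dfE] := fG x; rewrite -dfE -deriveE//.
set D := derive f x _; set c := f y - f x.
suff : D <= c by rewrite /c; lra.
rewrite leNgt; apply/negP => cD.
have /cvgrPdist_lt/(_ (D - c)) := @diff_derivable _ _ _ _ _ (y - x) df.
rewrite subr_gt0 => /(_ cD)[e /= e0 He].
pose t := Num.min (e / 2) 1.
have t0 : 0 < t by rewrite lt_min ltr01 divr_gt0.
have te : t < e by rewrite gt_min; apply/orP; left; lra.
have t1 : t <= 1 by rewrite ge_min lexx orbT.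
have := He t; rewrite /ball_ /= sub0r normrN gtr0_norm// => /(_ te).
rewrite gt_eqF// => /(_ isT)/(le_lt_trans (ler_norm _)).
rewrite ltrD2l ltrN2; apply/negP; rewrite -leNgt.
have t01 : 0 <= t <= 1 by rewrite t1 ltW.
have := convex_segment x (y - x) cf t01.
rewrite [x + (y - x)]addrC subrK [x + t *: _]addrC -/c => H.
by rewrite /= /GRing.scale /= ler_pdivrMl//; move: H; rewrite lerBlDl.
Qed.

Lemma lipschitz_sqr G (L : R) x y : lipschitz_with G L ->
  dotv (G x - G y) (G x - G y) <= L ^+ 2 * dotv (x - y) (x - y).
Proof.
move=> GL; rewrite -!sqr_enorm -exprMn lerXn2r ?nnegrE ?enorm_ge0//.
exact: le_trans (enorm_ge0 _) (GL x y).
Qed.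

(** Young's inequality with weight [(L * t)^-1] bounds both squares by [L t |d|^2]. *)
Lemma lipschitz_dotv G (L : R) t x d : 0 < L -> 0 < t -> lipschitz_with G L ->
  dotv (G (x + t *: d) - G x) d <= L * t * dotv d d.
Proof.
move=> L0 t0 GL; have := lipschitz_sqr (x + t *: d) x GL.
rewrite [x + _]addrC addrK dotvZl dotvZr.
set D := G _ - G x => H; have Lt : 0 < L * t by rewrite mulr_gt0.
have Lt' : 0 < (L * t)^-1 by rewrite invr_gt0.
have := dotv_young D d Lt'; rewrite invrK.
have := ler_wpM2l (ltW Lt') H.
have -> : (L * t)^-1 * (L ^+ 2 * (t * (t * dotv d d))) = L * t * dotv d d.
  by field; rewrite !gt_eqF.
lra.
Qed.

(* Summing the gradient inequality over a partition of the segment into N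
   pieces gives the quadratic bound with an extra error of order 1/N. *)
Lemma descent f G (L : R) x y : 0 < L -> convex_fun f -> is_gradient f G ->
  lipschitz_with G L ->
  f y <= f x + dotv (G x) (y - x) + L / 2 * dotv (y - x) (y - x).
Proof.
move=> L0 cf fG GL; pose d := y - x; have -> : y = x + d by rewrite addrC subrK.
rewrite [x + d]addrC addrK [d + x]addrC.
set q := dotv d d; have q0 : 0 <= q := dotvv_ge0 d.
have part (N j : nat) : let s := N.+1%:R^-1 in
    f (x + (j%:R * s) *: d) <=
    f x + j%:R * s * dotv (G x) d + L * q * s ^+ 2 * (j%:R * (j%:R + 1) / 2).
  move=> s; have s0 : 0 < s by rewrite invr_gt0 ltr0n.
  elim: j => [|j IH]; first by rewrite !mul0r scale0r !mulr0 !addr0.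
  set t := (j.+1)%:R * s.
  have t0 : 0 < t by rewrite mulr_gt0// ltr0n.
  (* The tangent is taken at the far end of the piece, so that it bounds the increase from above.
     Piece [j] adds [L q s^2 (j + 1)], whence the triangular number. *)
  have := convex_gradient_le (x + t *: d) (x + (j%:R * s) *: d) cf fG.
  have -> : x + (j%:R * s) *: d - (x + t *: d) = - (s *: d).
    rewrite /t -natr1 mulrDl mul1r scalerDl.
    by rewrite opprD addrACA subrr add0r opprD addrA subrr add0r.
  rewrite dotvNr dotvZr => H1.
  have := lipschitz_dotv x d L0 t0 GL.
  rewrite dotvDl dotvNl -/q => H2.
  have := ler_wpM2l (ltW s0) H2.
  have -> : t = j%:R * s + s by rewrite /t -natr1; ring.
  rewrite -[j.+1%:R]natr1.
  have -> : x + (j%:R * s + s) *: d = x + t *: d by rewrite /t -natr1 mulrDl mul1r.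
  move: IH H1; set A := f _; set A' := f _; set B := dotv _ _; set C := dotv _ _.
  lra.
apply: le_of_eps => e e0.
have [N HN] : exists N : nat, L * q / 2 / e < N%:R.
  by exists (Num.Def.truncn (L * q / 2 / e)).+1; rewrite truncnS_gt.
have := part N N.+1; rewrite /= mulfV ?pnatr_eq0// scale1r mul1r.
have N0 : 0 < N.+1%:R :> R by rewrite ltr0n.
have -> : L * q * N.+1%:R^-1 ^+ 2 * (N.+1%:R * (N.+1%:R + 1) / 2) =
  L / 2 * q + L * q / 2 / N.+1%:R by field; rewrite gt_eqF.
set w := L * q / 2 / N.+1%:R => H; suff : w <= e by clear -H; lra.
rewrite /w.
rewrite ler_pdivrMr// [e * _]mulrC -ler_pdivrMr//.
by rewrite (le_trans (ltW HN))// ler_nat.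
Qed.

Section Minimizer.
Variables (g : 'rV[R]_n -> R) (G : 'rV[R]_n -> 'rV[R]_n) (L : R).
Hypotheses (L0 : 0 < L) (cg : convex_fun g) (gG : is_gradient g G).
Hypotheses (GL : lipschitz_with G L) (g0 : forall x, 0 <= g x).

(** A gradient step of length [1 / L] lowers [g] by at least the left-hand side, and the value
    reached is still nonnegative. *)
Lemma sqr_gradient_le x : dotv (G x) (G x) / (2 * L) <= g x.
Proof.
have := descent x (x - L^-1 *: G x) L0 cg gG GL.
have := g0 (x - L^-1 *: G x).
rewrite [x - _]addrC addrK !dotvE; set q := dotv _ _ => H1 H2.
have -> : q / (2 * L) = q / L / 2 by field; rewrite gt_eqF.
move: H2; have -> : L / 2 * - - (L^-1 * (L^-1 * q)) = q / L / 2.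
  by field; rewrite gt_eqF.
by rewrite mulrC; lra.
Qed.

Lemma gradient_minimizer u : g u = 0 -> dotv (G u) (G u) = 0.
Proof.
move=> gu; apply/le_anti; rewrite dotvv_ge0 andbT.
by have := sqr_gradient_le u; rewrite gu ler_pdivrMr ?mulr_gt0// mul0r.
Qed.

(** At [z = u + G x / L], the tangent at [x] bounds [g z] from below and the descent lemma at [u],
    where the gradient vanishes, bounds it from above. The length [1 / L] optimizes the gap. *)
Lemma gradient_coercive x u : g u = 0 ->
  g x + dotv (G x) (G x) / (2 * L) <= dotv (G x) (x - u).
Proof.
move=> gu; set z := u + L^-1 *: G x.
have Gu : G u = 0.
  by apply: enorm_eq0; rewrite /enorm gradient_minimizer// sqrtr0.
have := descent u z L0 cg gG GL; have := convex_gradient_le x z cg gG.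
rewrite gu Gu dot0v !add0r /z [u + _ - u]addrC addKr.
rewrite !dotvE; set q := dotv (G x) (G x) => H1 H2.
have e1 : L / 2 * (L^-1 * (L^-1 * q)) = q / (2 * L) by field; rewrite gt_eqF.
have e2 : L^-1 * q = q / (2 * L) + q / (2 * L) by field; rewrite gt_eqF.
by move: H1 H2; rewrite e1 e2; lra.
Qed.

End Minimizer.

(** [prox] picks a minimizer by [xget], so existence must be shown. The linear lower bound of [f]
    makes the objective coercive, hence a minimizing sequence clusters; the same bound for the
    objective at the cluster point [p] acts as lower semicontinuity. *)
Lemma prox_minimizer r f x : (0 < n)%N -> 0 < r -> convex_fun f ->
  forall u, prox_obj r f x (prox r f x) <= prox_obj r f x u.
Proof.
move=> n0 r0 cf; pose P := [set p | forall u, prox_obj r f x p <= prox_obj r f x u].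
suff Pex : exists p, P p by exact: (xgetPex 0 Pex).
have [M M0 HM] := convex_linear_lower_bound x n0 cf.
set o := prox_obj r f x in P *.
have r2 : 0 < (2 * r)^-1 by rewrite invr_gt0; lra.
have o_lb u : f x - M * enorm (u - x) + (2 * r)^-1 * enorm (u - x) ^+ 2 <= o u.
  by rewrite /o /prox_obj lerD2r.
have o_ge u : f x - M ^+ 2 * r / 2 <= o u.
  apply: (le_trans _ (o_lb u)); set e := enorm _.
  rewrite -subr_ge0.
  have -> : f x - M * e + (2 * r)^-1 * e ^+ 2 - (f x - M ^+ 2 * r / 2) =
     (2 * r)^-1 * (e - M * r) ^+ 2 by field; rewrite gt_eqF.
  by rewrite mulr_ge0 ?sqr_ge0 ?ltW.
have ox : o x = f x by rewrite /o /prox_obj subrr sqr_enorm dot0v mulr0 addr0.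
pose A := range o.
have infA : has_inf A.
  by split; [exists (o x), x|exists (f x - M ^+ 2 * r / 2) => _ [u _ <-]].
(* Keeping [o u <= o x] is what bounds the minimizing sequence: it yields [e^2 / (2 r) <= M e] for
   [e = |u - x|]. *)
have near_inf (j : nat) : exists u, o u < inf A + j.+1%:R^-1 /\ o u <= o x.
  have j0 : (0 : R) < j.+1%:R^-1 by rewrite invr_gt0 ltr0n.
  have [_ [u _ <-] Hu] := inf_adherent j0 infA.
  have [oux|oux] := leP (o u) (o x); first by exists u.
  by exists x; split => //; exact: lt_trans oux Hu.
have [y Hy] := choice near_inf.
have ybd j : enorm (y j - x) <= 2 * r * M.
  have [_] := Hy j; rewrite ox => H; have := o_lb (y j); set e := enorm _ => H'.
  have e0 : 0 <= e := enorm_ge0 _.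
  have [->|en0] := eqVneq e 0; first by rewrite !mulr_ge0//; lra.
  have e1 : 0 < e by rewrite lt_neqAle eq_sym en0.
  have : (2 * r)^-1 * e * e <= M * e by move: H'; rewrite expr2; lra.
  by rewrite ler_pM2r// ler_pdivrMl//; lra.
have [p Hp] := bounded_rV_cluster n0 ybd.
exists p => u; apply: (@le_trans _ _ (inf A)); last first.
  by apply: ge_inf; [exact: infA.2|exists u].
have [M' M'0 HM'] := convex_linear_lower_bound p n0 (convex_prox_obj x r0 cf).
apply: le_of_eps => e e0.
have [N HN] : exists N : nat, (e / 2)^-1 < N%:R.
  by exists (Num.Def.truncn (e / 2)^-1).+1; rewrite truncnS_gt.
have M'1 : 0 < M' + 1 by lra.
have e2 : 0 < e / 2 / (M' + 1) by rewrite !divr_gt0.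
have [j Nj Hj] := Hp _ N e2.
have [H1 _] := Hy j; have := HM' (y j).
have : M' * enorm (y j - p) <= e / 2.
  have : enorm (y j - p) * (M' + 1) <= e / 2 by rewrite -ler_pdivlMr// ltW.
  have := enorm_ge0 (y j - p); lra.
have : j.+1%:R^-1 <= e / 2.
  rewrite invf_ple ?posrE ?divr_gt0// ?ltr0n//.
  by rewrite (le_trans (ltW HN))// ler_nat ltnW.
move: H1; set w := j.+1%:R^-1; set v := M' * _; rewrite -/o; lra.
Qed.

(** Compare [p] with [p + t (y - p)], divide by [t] and let [t] vanish; the quadratic term is of
    order [t]. *)
Lemma prox_variational r f x y (p := prox r f x) : (0 < n)%N -> 0 < r -> convex_fun f ->
  2 * r * (f p - f y) <= 2 * dotv (p - x) (y - p).
Proof.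
move=> n0 r0 cf; have Hp := prox_minimizer x n0 r0 cf; rewrite -/p in Hp.
suff : 0 <= f y - f p + r^-1 * dotv (p - x) (y - p).
  move=> /(ler_wpM2l (ltW r0)); rewrite mulr0 mulrDr mulVKf ?gt_eqF//; lra.
apply: (@ge0_of_segment _ _ ((2 * r)^-1 * dotv (y - p) (y - p))) => t t01.
have t01' : 0 <= t <= 1 by lra.
have := Hp (p + t *: (y - p)); have := convex_segment p (y - p) cf t01'.
rewrite [p + (y - p)]addrC subrK /prox_obj !sqr_enorm.
have -> : p + t *: (y - p) - x = (p - x) + t *: (y - p) by rewrite addrAC.
rewrite !(dotvDl (p - x)) !(dotvDr (p - x)) !dotvZl !dotvZr (dotvC (y - p) (p - x)).
set b := dotv (p - x) (y - p); set c := dotv (y - p) (y - p); set e := dotv _ _ => H1 H2.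
have : 0 <= t * (f y - f p + r^-1 * b + t * ((2 * r)^-1 * c)).
  have -> : t * (f y - f p + r^-1 * b + t * ((2 * r)^-1 * c)) =
    t * (f y - f p) + ((2 * r)^-1 * (e + t * b + (t * b + t * (t * c))) - (2 * r)^-1 * e).
    by field; rewrite gt_eqF.
  lra.
by rewrite pmulr_rge0//; lra.
Qed.

End Smooth.

(** * Summable and quasi-Fejer sequences *)

Section RealSequences.
Variable R : realType.
Implicit Types (a s e c : nat -> R).

(** Below, summability means bounded real partial sums. Each term is finite because it is at most
    the finite total. *)
Lemma nneseries_real (T : nat -> \bar R) : (forall k, (0 <= T k)%E) ->
  (\sum_(0 <= k <oo) T k < +oo)%E ->
  exists e, [/\ forall k, T k = (e k)%:E, forall k, 0 <= e k &
    exists B, forall N, \sum_(k < N) e k <= B].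
Proof.
move=> T0 Tfin.
have part N : (\sum_(k < N) T k <= \sum_(0 <= k <oo) T k)%E.
  by rewrite -(big_mkord xpredT T); apply: nneseries_lim_ge => k _ _; exact: T0.
have Sfin : (\sum_(0 <= k <oo) T k)%E \is a fin_num.
  by rewrite ge0_fin_numE//; apply: nneseries_ge0 => k _ _; exact: T0.
have TE k : T k = (fine (T k))%:E.
  rewrite fineK// ge0_fin_numE//; apply: (le_lt_trans _ Tfin).
  apply: (le_trans _ (part k.+1)); rewrite big_ord_recr /= leeDr//.
  by apply: sume_ge0 => i _; exact: T0.
exists (fun k => fine (T k)); split => // [k|]; first exact: fine_ge0.
exists (fine (\sum_(0 <= k <oo) T k)%E) => N.
rewrite -lee_fin fineK// -sumEFin; apply: (le_trans _ (part N)).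
by apply: lee_sum => i _; rewrite -TE.
Qed.

Lemma divergent_series_gt a (B : R) : (forall k, 0 <= a k) ->
  (\sum_(0 <= k <oo) (a k)%:E = +oo)%E -> exists N, B < \sum_(k < N) a k.
Proof.
move=> a0 aoo; apply: contrapT => H.
suff : (\sum_(0 <= k <oo) (a k)%:E <= B%:E)%E by rewrite aoo leye_eq.
apply: lime_le; first by apply: is_cvg_nneseries => k _ _; rewrite lee_fin.
exists 0%N => // N _ /=; rewrite big_mkord sumEFin lee_fin leNgt.
by apply/negP => HN; apply: H; exists N.
Qed.

Lemma bounded_sums_shift e (K : nat) (B : R) : (forall k, 0 <= e k) ->
  (forall N, \sum_(k < N) e k <= B) -> forall N, \sum_(k < N) e (K + k)%N <= B.
Proof.
move=> e0 eB N; apply: (le_trans _ (eB (K + N)%N)).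
by rewrite big_split_ord /= lerDr sumr_ge0.
Qed.

(** Take [K] with partial sum within [eta] of the supremum; the bound is uniform in the start and
    the length of the block. *)
Lemma bounded_sums_tail e (B : R) : (forall k, 0 <= e k) ->
  (forall N, \sum_(k < N) e k <= B) -> forall eta : R, 0 < eta ->
  exists K : nat, forall k j, (K <= k)%N -> \sum_(i < j) e (k + i)%N < eta.
Proof.
move=> e0 eB eta eta0; pose A := range (fun N => \sum_(k < N) e k).
have supA : has_sup A.
  by split; [exists (\sum_(k < 0) e k), 0%N|exists B => _ [N _ <-]].
have [_ [K _ <-] HK] := sup_adherent eta0 supA.
exists K => k j Kk; have := bounded_sums_shift K e0 eB.
have : \sum_(i < k + j) e i <= sup A by apply: sup_upper_bound => //; exists (k + j)%N.
rewrite big_split_ord /=.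
have : \sum_(i < K) e i <= \sum_(i < k) e i.
  by rewrite -(subnKC Kk) big_split_ord /= lerDl sumr_ge0.
lra.
Qed.

Lemma bounded_sums_cvg0 e (B : R) : (forall k, 0 <= e k) ->
  (forall N, \sum_(k < N) e k <= B) -> forall eta : R, 0 < eta ->
  exists K : nat, forall k, (K <= k)%N -> e k < eta.
Proof.
move=> e0 eB eta eta0; have [K HK] := bounded_sums_tail e0 eB eta0.
by exists K => k Kk; have := HK k 1%N Kk; rewrite big_ord1 addn0.
Qed.

Section QuasiFejer.
Variables (a s e : nat -> R) (B : R).
Hypotheses (a0 : forall k, 0 <= a k) (s0 : forall k, 0 <= s k).
Hypotheses (e0 : forall k, 0 <= e k) (eB : forall N, \sum_(k < N) e k <= B).
Hypothesis step : forall k, a k.+1 + s k <= a k + e k.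

Lemma quasi_fejer_sum k j :
  a (k + j)%N + \sum_(i < j) s (k + i)%N <= a k + \sum_(i < j) e (k + i)%N.
Proof.
elim: j => [|j IH]; first by rewrite !big_ord0 addn0.
by rewrite !big_ord_recr /= addnS; have := step (k + j); lra.
Qed.

Lemma quasi_fejer_bounded k : a k <= a 0%N + B.
Proof.
have := quasi_fejer_sum 0 k; have := eB k; have : 0 <= \sum_(i < k) s i by rewrite sumr_ge0.
by rewrite add0n; lra.
Qed.

Lemma quasi_fejer_summable N : \sum_(k < N) s k <= a 0%N + B.
Proof. have := quasi_fejer_sum 0 N; have := eB N; have := a0 N; rewrite add0n; lra. Qed.

(** After a late index where [a] is small, [a] can grow only by a tail of the errors. *)
Lemma quasi_fejer_cvg0 :
  (forall (eta : R) (K : nat), 0 < eta -> exists2 k, (K <= k)%N & a k < eta) ->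
  a @ \oo --> 0.
Proof.
move=> inf0; apply/cvgrPdist_lt => eta eta0.
have eta2 : 0 < eta / 2 by rewrite divr_gt0.
have [K HK] := bounded_sums_tail e0 eB eta2.
have [k Kk Hk] := inf0 _ K eta2.
exists k => // j /= kj; rewrite sub0r normrN ger0_norm// -(subnKC kj).
have := quasi_fejer_sum k (j - k); have := HK k (j - k)%N Kk.
have : 0 <= \sum_(i < j - k) s (k + i)%N by rewrite sumr_ge0.
lra.
Qed.

End QuasiFejer.

(** The limsup is an infimum of suprema over tails, so some tail has its supremum below [M]. The
    strict gap to [M'] later gives the slack in the step size. *)
Lemma limn_esup_lt c (M : R) : (limn_esup (fun k => (c k)%:E) < M%:E)%E ->
  exists2 M' : R, M' < M & exists K : nat, forall k, (K <= k)%N -> c k <= M'.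
Proof.
move=> /ereal_inf_lt[_ [V [K _ KV] <-]] supM.
set X := ereal_sup _ in supM.
have ub k : (K <= k)%N -> ((c k)%:E <= X)%E.
  by move=> Kk; apply: ereal_sup_ubound; exists k => //; exact: KV.
have Xfin : X \is a fin_num.
  rewrite fin_numE; apply/andP; split.
    by apply/eqP => XE; have := ub K (leqnn _); rewrite XE leeNy_eq.
  by apply/eqP => XE; move: supM; rewrite XE.
exists (fine X); first by rewrite -lte_fin fineK.
by exists K => k /ub; rewrite -{1}(fineK Xfin) lee_fin.
Qed.

Lemma limn_einf_gt c (m : R) : (m%:E < limn_einf (fun k => (c k)%:E))%E ->
  exists2 m' : R, m < m' & exists K : nat, forall k, (K <= k)%N -> m' <= c k.
Proof.
rewrite /limn_einf lteNr -EFinN => /(@limn_esup_lt (fun k => - c k))[M' M'm [K HK]].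
exists (- M'); first by rewrite ltrNr.
by exists K => k /HK; rewrite lerNl.
Qed.

End RealSequences.

(** * The iteration *)

(** Each step uses [|A + d|^2 <= 2 |A|^2 + 2 |d|^2]; the geometric factor is harmless because the
    number of steps is fixed. *)
Lemma sqr_path_le (R : realType) (n : nat) (phi : nat -> 'rV[R]_n) (i : nat) :
  dotv (phi i - phi 0%N) (phi i - phi 0%N) <=
  2 ^+ i * \sum_(j < i) dotv (phi j.+1 - phi j) (phi j.+1 - phi j).
Proof.
elim: i => [|i IH]; first by rewrite big_ord0 subrr dot0v mulr0.
rewrite big_ord_recr exprS /=.
have -> : phi i.+1 - phi 0%N = (phi i - phi 0%N) + (phi i.+1 - phi i).
  by rewrite [RHS]addrC addrA subrK.
move: IH; set A := phi i - phi 0%N; set d := phi i.+1 - phi i; set D := \sum_(j < i) _ => IH.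
clearbody A d.
have := dotv_young A d ltr01; rewrite invr1 !mul1r => Y.
have E1 : 1 <= 2 ^+ i :> R by rewrite exprn_ege1// ler1n.
have := dotvv_ge0 d; rewrite dotvDl !dotvDr (dotvC d A) => d0.
have := ler_wpM2r d0 E1; move: IH; set c : R := 2 ^+ i; lra.
Qed.

(** * One pass of proximal gradient steps *)

Section Pass.
Variables (R : realType) (n m : nat).
Variables (f h : nat -> 'rV[R]_n -> R) (gradh : nat -> 'rV[R]_n -> 'rV[R]_n).
Variables (L : nat -> R) (a : R) (phi : nat -> 'rV[R]_n).
Hypothesis n0 : (0 < n)%N.
Hypothesis cf : forall i, (i < m)%N -> convex_fun (f i).
Hypothesis hh : forall i, (i < m)%N -> convex_fun (h i) /\
  is_gradient (h i) (gradh i) /\ 0 < L i /\ lipschitz_with (gradh i) (L i).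
Hypotheses (a0 : 0 < a) (aL : forall i, (i < m)%N -> a * L i <= 1 / 2).
Hypothesis phiS : forall i, (i < m)%N ->
  phi i.+1 = prox a (f i) (phi i - a *: gradh i (phi i)).

Let F i x := f i x + h i x.
Let D k := \sum_(j < k) dotv (phi j.+1 - phi j) (phi j.+1 - phi j).

(** Expanding the square turns the prox inequality into a comparison of distances. The descent lemma
    for [h i] costs [a L_i |p - q|^2], and [a L_i <= 1/2] leaves half of the squared increment. *)
Lemma prox_grad_step i y : (i < m)%N ->
  dotv (phi i.+1 - y) (phi i.+1 - y) +
    dotv (phi i.+1 - phi i) (phi i.+1 - phi i) / 2 <=
  dotv (phi i - y) (phi i - y) + 2 * a * (F i y - F i (phi i.+1)).
Proof.
move=> im; have [ch [dh [L0 Lh]]] := hh im.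
have := prox_variational (phi i - a *: gradh i (phi i)) y n0 a0 (cf im).
rewrite -phiS//; set p := phi i.+1; set q := phi i; set G := gradh i q => H1.
have H2 := descent q p L0 ch dh Lh.
have H3 := convex_gradient_le q y ch dh.
rewrite -/G in H2 H3.
have e1 : dotv (q - y) (q - y) =
    dotv (p - y) (p - y) + dotv (p - q) (p - q) + 2 * dotv (p - q) (y - p).
  by rewrite !dotvE (dotvC q y) (dotvC p y) (dotvC p q); ring.
have e2 : 2 * dotv (p - (q - a *: G)) (y - p) =
    2 * dotv (p - q) (y - p) + 2 * a * (dotv G (y - q) - dotv G (p - q)).
  by rewrite !dotvE; ring.
have := ler_wpM2r (dotvv_ge0 (p - q)) (aL im).
move: H1 H2 H3; rewrite e1 e2 /F.
set s := dotv (p - q) (p - q); set b := dotv G (y - q); set c := dotv G (p - q).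
set t := dotv (p - q) (y - p) => H1 H2 H3 H4.
have := ler_wpM2l (ltW a0) H2; have := ler_wpM2l (ltW a0) H3.
lra.
Qed.

Lemma pass_sum k y : (k <= m)%N ->
  dotv (phi k - y) (phi k - y) + D k / 2 <=
  dotv (phi 0%N - y) (phi 0%N - y) + 2 * a * \sum_(i < k) (F i y - F i (phi i.+1)).
Proof.
elim: k => [|k IH] km; first by rewrite /D !big_ord0; lra.
have := prox_grad_step y km; have := IH (ltnW km).
rewrite /D !big_ord_recr /=; lra.
Qed.

Lemma pass_dist i : (i <= m)%N ->
  dotv (phi i - phi 0%N) (phi i - phi 0%N) <= 2 ^+ m * D m.
Proof.
move=> im; apply: (le_trans (sqr_path_le phi i)).
have D0 k : 0 <= D k by apply: sumr_ge0 => j _; exact: dotvv_ge0.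
apply: ler_pM; [by rewrite exprn_ge0|exact: D0| |].
  by rewrite ler_eXn2l// ltr1n.
rewrite /D -(subnKC im) big_split_ord /= lerDl.
by apply: sumr_ge0 => j _; exact: dotvv_ge0.
Qed.

(** The subgradient inequalities hold at the points [phi i.+1]. Moving them all to [phi 0] lets the
    [- w i] add up to [p]; Young's inequality charges the shifts to [a^2 |w_i|^2] and to the path
    length. *)
Lemma pass_kkt u p (w : nat -> 'rV[R]_n) : (0 < m)%N ->
  (forall i y, (i < m)%N -> F i u + dotv (w i) (y - u) <= F i y) ->
  \sum_(i < m) w i + p = 0 ->
  2 * a * \sum_(i < m) (F i u - F i (phi i.+1)) <=
  2 * a * dotv p (phi 0%N - u) +
    4 * m%:R * 2 ^+ m * a ^+ 2 * \sum_(i < m) dotv (w i) (w i) + D m / 4.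
Proof.
move=> m0 wF wp.
(* With this weight the [m] terms [l^-1 * (2 ^+ m * D m)] add up to [D m / 4]. *)
set l : R := 4 * m%:R * 2 ^+ m.
have m0' : 0 < m%:R :> R by rewrite ltr0n.
have l0 : 0 < l by rewrite !mulr_gt0// exprn_gt0.
have one (i : 'I_m) : 2 * a * (F i u - F i (phi i.+1)) <=
    2 * a * dotv (- w i) (phi 0%N - u) + l * a ^+ 2 * dotv (w i) (w i) +
    l^-1 * (2 ^+ m * D m).
  have := wF i (phi i.+1) (ltn_ord i).
  have := pass_dist (ltn_ord i).
  have := dotv_young (- (a *: w i)) (phi i.+1 - phi 0%N) l0.
  have -> : dotv (- (a *: w i)) (- (a *: w i)) = a ^+ 2 * dotv (w i) (w i).
    by rewrite !dotvE; ring.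
  have -> : 2 * dotv (- (a *: w i)) (phi i.+1 - phi 0%N) =
      2 * a * dotv (- w i) (phi i.+1 - u) - 2 * a * dotv (- w i) (phi 0%N - u).
    by rewrite !dotvE; ring.
  rewrite !(dotvNl (w i)) => H1 H2 H3.
  have il : 0 <= l^-1 by rewrite invr_ge0 ltW.
  have := ler_wpM2l il H2; have := ler_wpM2l (ltW a0) H3.
  move: H1; set A := dotv (w i) _; set B := dotv (w i) _; set W := dotv (w i) _.
  set X := l^-1 * _; set Y := l^-1 * _; lra.
rewrite mulr_sumr; apply: (le_trans (ler_sum _ (fun i _ => one i))).
rewrite !big_split /= sumr_const card_ord -!mulr_sumr.
have -> : \sum_(i < m) dotv (- w i) (phi 0%N - u) = dotv p (phi 0%N - u).
  rewrite -(dotv_suml m (fun i => - w i)) sumrN; congr dotv.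
  by apply/eqP; rewrite eq_sym -addr_eq0 addrC wp.
have -> : l^-1 * (2 ^+ m * D m) *+ m = D m / 4.
  by rewrite -mulr_natr /l; field; rewrite !gt_eqF// exprn_gt0.
by [].
Qed.

End Pass.

(** * The explicit gradient step on the penalty *)

Section ForwardStep.
Variables (R : realType) (n : nat) (g : 'rV[R]_n -> R) (G : 'rV[R]_n -> 'rV[R]_n).
Variables (L s th : R).
Hypotheses (L0 : 0 < L) (cg : convex_fun g) (gG : is_gradient g G).
Hypotheses (GL : lipschitz_with G L) (g0 : forall x, 0 <= g x).
Hypotheses (s0 : 0 < s) (th0 : 0 < th) (th1 : th <= 1).
Hypothesis sL : (1 + th) * s <= 2 * (1 - th) / L.

(** Of the coercivity bound, a share [th] is kept as a decrease of [g] and the rest is turned into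
    squared gradient. By [sL], a form of [s < 2 / L] with slack, this pays for [s^2 |G x|^2] and
    leaves a share [th] of it. *)
Lemma forward_step x u : g u = 0 ->
  dotv (x - s *: G x - u) (x - s *: G x - u) +
    2 * th * s * g x + th * s ^+ 2 * dotv (G x) (G x) <= dotv (x - u) (x - u).
Proof.
move=> gu; have H1 := gradient_coercive L0 cg gG GL g0 x gu.
have H2 := sqr_gradient_le L0 cg gG GL g0 x.
have -> : dotv (x - s *: G x - u) (x - s *: G x - u) =
    dotv (x - u) (x - u) - 2 * s * dotv (G x) (x - u) + s ^+ 2 * dotv (G x) (G x).
  by rewrite !dotvE !(dotvC (G x)) (dotvC u x); ring.
have q0 := dotvv_ge0 (G x).
move: H1 H2; set q := dotv (G x) (G x) in q0 *.
have -> : q / (2 * L) = q / L / 2 by field; rewrite gt_eqF.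
set w := q / L; set b := dotv (G x) (x - u) => H1 H2.
have th1' : 0 <= 1 - th by rewrite subr_ge0.
have thw : 0 <= th * w by rewrite mulr_ge0 ?divr_ge0// ltW.
have H3 : th * g x + (1 - th) * w <= b.
  by have := ler_wpM2l th1' H2; lra.
have := ler_wpM2l (ltW s0) H3.
have H4 : (1 + th) * s * q <= 2 * (1 - th) * w.
  have := ler_wpM2r q0 sL.
  have -> : 2 * (1 - th) / L * q = 2 * (1 - th) * w by rewrite /w; ring.
  by [].
have := ler_wpM2l (ltW s0) H4.
lra.
Qed.

End ForwardStep.

(** * Multipliers at a solution and the penalization gap *)

Section Optimality.
Variables (R : realType) (n : nat) (g : 'rV[R]_n -> R).
Implicit Types (u x y p q : 'rV[R]_n).

Lemma argmin_zero u : (exists x, g x = 0) -> (forall x, 0 <= g x) ->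
  argmin g u <-> g u = 0.
Proof.
move=> [x gx] g0; split => [gu|gu y]; last by rewrite gu.
by apply/le_anti; rewrite g0 andbT -gx; exact: gu.
Qed.

Lemma argmin_segment u y (t : R) : convex_fun g -> 0 <= t <= 1 ->
  argmin g u -> argmin g y -> argmin g (u + t *: (y - u)).
Proof.
move=> cg t01 gu gy z; apply: (le_trans _ (gu z)).
have := convex_segment u (y - u) cg t01; rewrite [u + (y - u)]addrC subrK.
have -> : g y = g u by apply/le_anti; rewrite gu gy.
by rewrite subrr mulr0 addr0.
Qed.

(** Minimality along segments makes minus the sum of the gradients of the [h i] a subgradient of the
    nonsmooth part plus indicator. (H1) splits it, and adding each gradient back gives subgradients
    of [f i + h i]. *)
Lemma minimizer_kkt m (f h : nat -> 'rV[R]_n -> R)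
    (gradh : nat -> 'rV[R]_n -> 'rV[R]_n) (L : nat -> R) u :
  convex_fun g ->
  (forall i, (i < m)%N -> convex_fun (f i)) ->
  (forall i, (i < m)%N -> convex_fun (h i) /\ is_gradient (h i) (gradh i) /\
                          0 < L i /\ lipschitz_with (gradh i) (L i)) ->
  subdiffE (fun y => ((\sum_(i < m) f i y)%:E + delta_set (argmin g) y)%E) u =
     [set v | exists (w : nat -> 'rV[R]_n) (p : 'rV[R]_n),
                (forall i, (i < m)%N -> subdiff (f i) u (w i)) /\
                normal_cone (argmin g) u p /\
                v = \sum_(i < m) w i + p] ->
  argmin g u ->
  (forall y, argmin g y ->
    \sum_(i < m) (f i u + h i u) <= \sum_(i < m) (f i y + h i y)) ->
  exists (w : nat -> 'rV[R]_n) p,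
    [/\ forall i y, (i < m)%N -> f i u + h i u + dotv (w i) (y - u) <= f i y + h i y,
        normal_cone (argmin g) u p & \sum_(i < m) w i + p = 0].
Proof.
move=> cg cf hh H1 gu uopt.
pose v := - \sum_(i < m) gradh i u.
have deltaE y : argmin g y -> delta_set (argmin g) y = 0%E.
  by move=> gy; rewrite /delta_set asboolT.
have : subdiffE (fun y => ((\sum_(i < m) f i y)%:E + delta_set (argmin g) y)%E) u v.
  split=> [|y]; first by rewrite deltaE// adde0.
  rewrite (deltaE u)// adde0.
  have [gy|gy] := pselect (argmin g y); last by rewrite /delta_set asboolF// addey// leey.
  rewrite deltaE// adde0 -EFinD lee_fin -subr_ge0 /v dotvNl (dotv_suml m (fun i => gradh i u)).
  (* The term of order [t] collects the quadratic remainders of the descent lemma for the [h i]. *)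
  apply: (@ge0_of_segment _ _
    (\sum_(i < m) (L i / 2 * dotv (y - u) (y - u)))) => t t01.
  have t01' : 0 <= t <= 1 by lra.
  have t0 : 0 < t by lra.
  rewrite -(pmulr_rge0 _ t0).
  have := uopt _ (argmin_segment cg t01' gu gy).
  suff : \sum_(i < m) (f i (u + t *: (y - u)) + h i (u + t *: (y - u))) <=
      \sum_(i < m) (f i u + h i u + (t * (f i y - f i u) + t * dotv (gradh i u) (y - u) +
        t ^+ 2 * (L i / 2 * dotv (y - u) (y - u)))).
    rewrite !big_split /= -!mulr_sumr sumrB.
    set a1 := \sum_(i < m) f i u; set a2 := \sum_(i < m) f i y.
    set a3 := \sum_(i < m) dotv _ _; rewrite expr2; lra.
  apply: ler_sum => i _; have im := ltn_ord i.
  have [ch [dh [L0 Lh]]] := hh i im.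
  have := convex_segment u (y - u) (cf i im) t01'.
  have := descent u (u + t *: (y - u)) L0 ch dh Lh.
  rewrite [u + (y - u)]addrC subrK [u + t *: (y - u)]addrC addrK !dotvZr dotvZl.
  rewrite expr2; lra.
rewrite H1 => -[w [p [wf [pu vE]]]].
exists (fun i => w i + gradh i u), p; split => //; last first.
  rewrite big_split /= addrAC -vE /v addrC subrr //.
move=> i y im; have [_ /(_ y)] := wf i im.
rewrite -EFinD lee_fin; have [ch [dh [L0 Lh]]] := hh i im.
have := convex_gradient_le u y ch dh; rewrite dotvDl; lra.
Qed.

Lemma support_fun_normal (X : set 'rV[R]_n) u p : normal_cone X u p ->
  support_fun X p = (dotv u p)%:E.
Proof.
move=> [Xu pu]; apply/le_anti/andP; split.
  apply: ge_ereal_sup => _ [y Xy <-]; rewrite lee_fin.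
  by have := pu y Xy; rewrite !dotvE (dotvC p y) (dotvC p u) subr_le0.
by apply: ereal_sup_ubound; exists u.
Qed.

Lemma normal_coneZ (X : set 'rV[R]_n) u p (t : R) : 0 <= t ->
  normal_cone X u p -> normal_cone X u (t *: p).
Proof.
move=> t0 [Xu pu]; split => // y Xy; rewrite dotvZl.
by rewrite mulr_ge0_le0// pu.
Qed.

Lemma conjugate_gap_ge u p x : normal_cone (argmin g) u p ->
  ((dotv p (x - u) - g x)%:E <= conjugate g p - support_fun (argmin g) p)%E.
Proof.
move=> pu; rewrite (support_fun_normal pu) leeBrDr// -EFinD.
apply: ereal_sup_ubound; exists x => //; congr (_%:E).
by rewrite !dotvE (dotvC u p); ring.
Qed.

(** The gap inequality is applied to [q / beta k], which is still normal at [u], and multiplied by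
    [alpha k * beta k]. Taking [x = u] shows that the terms of (H4) are nonnegative. *)
Lemma penalization_bound (alpha beta : nat -> R) u q :
  (forall k, 0 < alpha k) -> (forall k, 0 < beta k) -> g u = 0 ->
  normal_cone (argmin g) u q ->
  (\sum_(0 <= k <oo) ((alpha k * beta k)%:E *
         (conjugate g ((beta k)^-1 *: q)
          - support_fun (argmin g) ((beta k)^-1 *: q))) < +oo)%E ->
  exists e : nat -> R, [/\ forall k, 0 <= e k,
    exists B, forall N, \sum_(k < N) e k <= B &
    forall k x, alpha k * dotv q (x - u) - alpha k * beta k * g x <= e k].
Proof.
move=> a0 b0 gu uq Tfin.
set T := (fun k => (alpha k * beta k)%:E * (conjugate g ((beta k)^-1 *: q)
   - support_fun (argmin g) ((beta k)^-1 *: q)))%E in Tfin.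
have Tge k x : ((alpha k * dotv q (x - u) - alpha k * beta k * g x)%:E <= T k)%E.
  have bk : 0 <= (beta k)^-1 by rewrite invr_ge0 ltW.
  have := conjugate_gap_ge x (normal_coneZ bk uq).
  have abk : (0%:E <= (alpha k * beta k)%:E)%E by rewrite lee_fin mulr_ge0 ?ltW.
  move=> /(lee_wpmul2l abk); apply: le_trans; rewrite -EFinM lee_fin dotvZl.
  rewrite le_eqVlt; apply/orP; left; apply/eqP; field; rewrite gt_eqF//.
have T0 k : (0 <= T k)%E.
  have := Tge k u; rewrite subrr gu mulr0 dotvC dot0v mulr0 subrr //.
have [e [Te e0 eB]] := nneseries_real T0 Tfin.
by exists e; split => // k x; rewrite -lee_fin -Te.
Qed.

End Optimality.

(** * Convergence of the iterates, given step size bounds valid from index [K] on *)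

Section Algorithm.
Variables (R : realType) (m n : nat).
Variables (f h : nat -> 'rV[R]_n -> R) (gradh : nat -> 'rV[R]_n -> 'rV[R]_n).
Variables (L : nat -> R) (g : 'rV[R]_n -> R) (gradg : 'rV[R]_n -> 'rV[R]_n) (Lg : R).
Variables (alpha beta : nat -> R) (x1 : 'rV[R]_n).
Hypotheses (m0 : (0 < m)%N) (n0 : (0 < n)%N).
Hypothesis cf : forall i, (i < m)%N -> convex_fun (f i).
Hypothesis hh : forall i, (i < m)%N -> convex_fun (h i) /\
  is_gradient (h i) (gradh i) /\ 0 < L i /\ lipschitz_with (gradh i) (L i).
Hypotheses (cg : convex_fun g) (dg : is_gradient g gradg) (Lg0 : 0 < Lg).
Hypotheses (gL : lipschitz_with gradg Lg) (gz : exists x, g x = 0).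
Hypotheses (g0 : forall x, 0 <= g x).
Hypotheses (a0 : forall k, 0 < alpha k) (b0 : forall k, 0 < beta k).

Let F x := \sum_(i < m) (f i x + h i x).
Let S := [set x | argmin g x /\ forall y, argmin g y -> F x <= F y].

Hypothesis H1 : forall x : 'rV[R]_n,
  subdiffE (fun y => ((\sum_(i < m) f i y)%:E + delta_set (argmin g) y)%E) x =
  [set v | exists (u : nat -> 'rV[R]_n) (p : 'rV[R]_n),
             (forall i, (i < m)%N -> subdiff (f i) x (u i)) /\
             normal_cone (argmin g) x p /\ v = \sum_(i < m) u i + p].
Hypothesis alpha_div : (\sum_(0 <= k <oo) (alpha k)%:E = +oo)%E.
Hypothesis alpha_sqr : exists B, forall N, \sum_(k < N) alpha k ^+ 2 <= B.
Hypothesis H4 : forall p, ran_normal_cone (argmin g) p ->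
  (\sum_(0 <= k <oo) ((alpha k * beta k)%:E *
      (conjugate g ((beta k)^-1 *: p)
       - support_fun (argmin g) ((beta k)^-1 *: p))) < +oo)%E.

Variables (K : nat) (c th : R).
Hypotheses (c0 : 0 < c) (th0 : 0 < th) (th1 : th <= 1).
Hypothesis ab_ge : forall k, (K <= k)%N -> c <= alpha k * beta k.
Hypothesis ab_le : forall k, (K <= k)%N ->
  (1 + th) * (alpha k * beta k) <= 2 * (1 - th) / Lg.
Hypothesis aL : forall k, (K <= k)%N -> forall i, (i < m)%N -> alpha k * L i <= 1 / 2.

Let x := xseq m f h gradh gradg alpha beta x1.
Let phi k := phi_it f h gradh gradg (alpha k) (beta k) (x k).
Let dist u k := dotv (x k - u) (x k - u).
Let D k := \sum_(j < m) dotv (phi k j.+1 - phi k j) (phi k j.+1 - phi k j).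
Let Fphi k := \sum_(i < m) (f i (phi k i.+1) + h i (phi k i.+1)).

Let ab0 k : 0 < alpha k * beta k.
Proof. by rewrite mulr_gt0. Qed.

Let D0 k : 0 <= D k.
Proof. by apply: sumr_ge0 => j _; exact: dotvv_ge0. Qed.

Let dist0 u k : 0 <= dist u k.
Proof. exact: dotvv_ge0. Qed.

Let argmin0 u : argmin g u <-> g u = 0.
Proof. exact: argmin_zero. Qed.

Lemma iterate_pass u k : (K <= k)%N ->
  dist u k.+1 + D k / 2 <= dotv (phi k 0%N - u) (phi k 0%N - u) +
    2 * alpha k * \sum_(i < m) (f i u + h i u - (f i (phi k i.+1) + h i (phi k i.+1))).
Proof.
by move=> Kk; exact: (pass_sum n0 cf hh (a0 k) (aL Kk) (fun i _ => erefl) u (leqnn m)).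
Qed.

Lemma iterate_forward u k : (K <= k)%N -> g u = 0 ->
  dotv (phi k 0%N - u) (phi k 0%N - u) + 2 * th * (alpha k * beta k) * g (x k) +
    th * (alpha k * beta k) ^+ 2 * dotv (gradg (x k)) (gradg (x k)) <= dist u k.
Proof.
by move=> Kk gu; exact: (forward_step Lg0 cg dg gL g0 (ab0 k) th0 th1 (ab_le Kk) (x k) gu).
Qed.

Lemma value_descent u k : (K <= k)%N -> g u = 0 ->
  dist u k.+1 + 2 * alpha k * (Fphi k - F u) <= dist u k.
Proof.
move=> Kk gu; have := iterate_pass u Kk; have := iterate_forward Kk gu.
rewrite sumrB -/(F u) -/(Fphi k); have := D0 k.
have : 0 <= 2 * th * (alpha k * beta k) * g (x k).
  by rewrite !mulr_ge0 ?(ltW th0) ?(ltW (a0 k)) ?(ltW (b0 k)).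
have : 0 <= th * (alpha k * beta k) ^+ 2 * dotv (gradg (x k)) (gradg (x k)).
  by rewrite mulr_ge0 ?dotvv_ge0// mulr_ge0 ?sqr_ge0// ltW.
lra.
Qed.

(* The penalization hypothesis is used at the multiplier scaled by [2 / th], so
   that half of the decrease of [g] absorbs the term [<p, x k - u>]. *)
Lemma quasi_fejer u : S u -> exists (e : nat -> R) (B : R),
  [/\ forall k, 0 <= e k, forall N, \sum_(k < N) e k <= B &
      forall k, (K <= k)%N ->
        dist u k.+1 + (th * c * g (x k) + D k / 4) <= dist u k + e k].
Proof.
move=> [gu uopt]; have gu0 := (argmin0 u).1 gu.
have [w [p [wF pu wp]]] := minimizer_kkt cg cf hh (H1 u) gu uopt.
have t2 : 0 <= 2 / th by rewrite divr_ge0// ltW.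
have qu := normal_coneZ t2 pu.
have [e [e0 [B eB] eP]] := penalization_bound a0 b0 gu0 qu (H4 (ex_intro _ u qu)).
have [B2 aB] := alpha_sqr.
pose C := th^-1 * dotv p p + 4 * m%:R * 2 ^+ m * \sum_(i < m) dotv (w i) (w i).
have C0 : 0 <= C.
  apply: addr_ge0; first by rewrite mulr_ge0 ?invr_ge0 ?dotvv_ge0// ltW.
  rewrite !mulr_ge0 ?exprn_ge0//.
  by apply: sumr_ge0 => i _; exact: dotvv_ge0.
exists (fun k => th * e k + C * alpha k ^+ 2), (th * B + C * B2); split.
- by move=> k; rewrite addr_ge0 ?mulr_ge0 ?sqr_ge0// ltW.
- move=> N; rewrite big_split /= -!mulr_sumr.
  by apply: lerD; rewrite ler_wpM2l ?eB ?aB// ltW.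
move=> k Kk; have := iterate_pass u Kk; have := iterate_forward Kk gu0.
have := pass_kkt (phi k) (a0 k) m0 wF wp.
have := eP k (x k); rewrite dotvZl.
have sx : phi k 0%N - u = x k - u - (alpha k * beta k) *: gradg (x k).
  by rewrite /phi /= addrAC.
(* Moving [p] from [phi k 0] to [x k] creates a cross term with the gradient of [g]. The weight
   [th^-1] makes its gradient part exactly the term left by the forward step; the other part enters
   [C]. *)
have := dotv_young (- (alpha k *: p)) ((alpha k * beta k) *: gradg (x k)).
move=> /(_ th^-1); rewrite invr_gt0 invrK => /(_ th0).
have -> : dotv p (phi k 0%N - u) =
    dotv p (x k - u) - alpha k * beta k * dotv p (gradg (x k)).
  by rewrite sx dotvDr dotvNr dotvZr.
rewrite !dotvZl !dotvZr !dotvNl !dotvNr !dotvZl !dotvZr.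
set s := alpha k * beta k; set GG := dotv (gradg _) _; set pG := dotv p (gradg _).
set px := dotv p (x k - u); set pp := dotv p p.
set W := \sum_(i < m) dotv (w i) (w i); set V := \sum_(i < m) _.
rewrite /C -/pp -/W.
have := ler_wpM2r (g0 (x k)) (ab_ge Kk); rewrite -/s => P0 P1 P2 P3 P4 P5.
have Q0 := ler_wpM2l (ltW th0) P0.
have Q2 := ler_wpM2l (ltW th0) P2.
have tE : th * (alpha k * (2 / th * px)) = 2 * alpha k * px by field; rewrite gt_eqF.
rewrite -/(D k) in P3 P5 *.
move: tE Q0 Q2 P1 P3 P4 P5.
set y1 := th^-1; set y2 := 2 ^+ m; lra.
Qed.

(** Otherwise [value_descent] would lower the distance by [2 eta alpha k] at every late step,
    against the divergence of the sum of [alpha]. *)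
Lemma value_liminf u (eta : R) (K1 : nat) : S u -> 0 < eta ->
  exists2 k, (K1 <= k)%N & Fphi k < F u + eta.
Proof.
move=> [/argmin0 gu _] eta0; apply: contrapT => H.
pose K2 := (K + K1)%N.
pose s k := 2 * eta * alpha (K2 + k)%N.
have step k : dist u (K2 + k.+1)%N + s k <= dist u (K2 + k)%N + 0.
  rewrite addr0 addnS.
  have Kk : (K <= K2 + k)%N by rewrite /K2 -addnA leq_addr.
  apply: (le_trans _ (value_descent Kk gu)); rewrite lerD2l /s mulrAC.
  rewrite ler_pM2l ?mulr_gt0//; rewrite lerBrDl leNgt; apply/negP => Hk.
  by apply: H; exists (K2 + k)%N => //; rewrite /K2 -addnA addnCA leq_addr.
have sum0 N : \sum_(k < N) (0 : R) <= 0 by rewrite big1.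
have bd := quasi_fejer_summable (a := fun k => dist u (K2 + k)%N)
  (fun k => dist0 u _) sum0 step.
have [N HN] := divergent_series_gt ((dist u K2 / (2 * eta)) + \sum_(k < K2) alpha k)
  (fun k => ltW (a0 k)) alpha_div.
have := bd N; rewrite addn0 addr0 /s -mulr_sumr mulrC -ler_pdivlMr ?mulr_gt0//.
have : \sum_(k < N) alpha k <= \sum_(k < K2 + N) alpha k.
  rewrite addnC big_split_ord /= lerDl; apply: sumr_ge0 => i _; exact: ltW.
rewrite [X in _ <= X -> _]big_split_ord /=; move: HN.
set z := dist u K2 / _; lra.
Qed.

(** All inner points approach [x k], as the right-hand side is a multiple of the summable decrease.
    The path contributes [2 ^+ m * D k]; the forward step uses [alpha k * beta k <= 2 / Lg] and
    [|gradg|^2 <= 2 Lg g]. *)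
Lemma phi_drift k i : (K <= k)%N -> (i <= m)%N ->
  dotv (phi k i - x k) (phi k i - x k) <=
  (8 * 2 ^+ m + 16 / (Lg * (th * c))) * (th * c * g (x k) + D k / 4).
Proof.
move=> Kk im; pose s := alpha k * beta k.
have sq2 (u v : 'rV[R]_n) : dotv (u - v) (u - v) <= 2 * dotv u u + 2 * dotv v v.
  by have := dotv_young u (- v) ltr01; rewrite !dotvE (dotvC v u) invr1; lra.
have thc : 0 < th * c by rewrite mulr_gt0.
have sLg : s * Lg <= 2.
  have := ab_le Kk; rewrite -/s ler_pdivlMr// => H.
  have sL0 : 0 <= th * (s * Lg) by rewrite !mulr_ge0// ltW.
  by have := th0; move: H sL0; lra.
have -> : phi k i - x k = (phi k i - phi k 0%N) - s *: gradg (x k).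
  have -> : phi k 0%N = x k - s *: gradg (x k) by [].
  by rewrite opprB -addrA [_ - x k - _]addrAC subrr add0r.
have dist_i := pass_dist (phi k) im.
have GG := sqr_gradient_le Lg0 cg dg gL g0 (x k).
set u := phi k i - _ in dist_i *; set v := s *: _.
apply: (le_trans (sq2 u v)).
have v_le : dotv v v <= 8 / Lg * g (x k).
  rewrite /v dotvZl dotvZr mulrA; move: GG; rewrite ler_pdivrMr ?mulr_gt0// => GG.
  have s2 : s * s <= 4 / Lg ^+ 2.
    rewrite ler_pdivlMr ?exprn_gt0//.
    have -> : s * s * Lg ^+ 2 = (s * Lg) ^+ 2 by ring.
    rewrite (_ : 4 = 2 ^+ 2); last by rewrite expr2; ring.
    by rewrite lerXn2r// ?nnegrE// mulr_ge0// ltW// ab0.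
  apply: (@le_trans _ _ (4 / Lg ^+ 2 * (g (x k) * (2 * Lg)))).
    by rewrite ler_pM ?dotvv_ge0// mulr_ge0// ltW// ab0.
  rewrite le_eqVlt; apply/orP; left; apply/eqP; field; rewrite gt_eqF//.
have -> : (8 * 2 ^+ m + 16 / (Lg * (th * c))) * (th * c * g (x k) + D k / 4) =
   2 * (2 ^+ m * D k) + 2 * (8 / Lg * g (x k)) +
   (8 * (2 ^+ m * (th * c * g (x k))) + 16 / (Lg * (th * c)) * (D k / 4)).
  by field; rewrite !gt_eqF.
have r1 : 0 <= 8 * (2 ^+ m * (th * c * g (x k))).
  by rewrite !mulr_ge0 ?exprn_ge0// ltW.
have r2 : 0 <= 16 / (Lg * (th * c)) * (D k / 4).
  by rewrite mulr_ge0// divr_ge0// ltW// !mulr_gt0.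
have := dist_i; rewrite -/(D k); move: v_le r1 r2.
set q1 := 8 * (_ * _); set q2 := _ / _ * (_ / 4); set q3 := _ / Lg * _; set q4 := _ * D k; lra.
Qed.

Lemma xseq_cvg : S !=set0 -> exists xs, S xs /\ (x @ \oo --> xs).
Proof.
move=> [u Su].
pose a u' k := dist u' (K + k)%N.
pose r k := th * c * g (x (K + k)%N) + D (K + k)%N / 4.
have r0 k : 0 <= r k by rewrite addr_ge0 ?divr_ge0// !mulr_ge0// ltW.
have shift u' : S u' -> exists (e : nat -> R) B, [/\ forall k, 0 <= e k,
    forall N, \sum_(k < N) e k <= B & forall k, a u' k.+1 + r k <= a u' k + e k].
  move=> /quasi_fejer[e [B [e0 eB step]]].
  exists (fun k => e (K + k)%N), B; split => // [|k].
    exact: bounded_sums_shift.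
  by rewrite /a addnS; exact: step (leq_addr _ _).
have [e [B [e0 eB step]]] := shift u Su.
have r_small := bounded_sums_cvg0 r0 (quasi_fejer_summable (fun k => dist0 u _) eB step).
pose P j k := (K + j <= k)%N /\ Fphi k < F u + j.+1%:R^-1.
have [kj kjP] : {kj : nat -> nat & forall j, P j (kj j)}.
  apply: choice => j.
  have j0 : (0 : R) < j.+1%:R^-1 by rewrite invr_gt0 ltr0n.
  by have [k Kk Hk] := value_liminf (K + j) Su j0; exists k.
have ybd j : enorm (x (kj j) - u) <= Num.sqrt (a u 0%N + B).
  have [Kk _] := kjP j.
  have Kk' : (K <= kj j)%N by apply: leq_trans Kk; exact: leq_addr.
  have := quasi_fejer_bounded r0 eB step (kj j - K); rewrite /a subnKC// /dist => H.
  rewrite /enorm ler_sqrt//; apply: le_trans H; exact: dotvv_ge0.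
have [l lP] := bounded_rV_cluster n0 ybd.
have near_l (eta : R) (J : nat) : 0 < eta -> exists k, [/\ (J <= k)%N,
    enorm (x k - l) < eta, g (x k) < eta, Fphi k < F u + eta &
    forall i, (i <= m)%N -> enorm (phi k i - l) < 2 * eta].
  move=> eta0.
  pose C := 8 * 2 ^+ m + 16 / (Lg * (th * c)).
  have thc : 0 < th * c by rewrite mulr_gt0.
  have C0 : 0 < C.
    apply: addr_gt0; first by rewrite mulr_gt0 ?exprn_gt0.
    by rewrite divr_gt0// mulr_gt0.
  (* The first entry makes [g (x k)] less than [eta], the second makes the squared drift less than
     [eta ^+ 2]. *)
  pose d := Num.min (th * c * eta) (eta ^+ 2 / C).
  have d0 : 0 < d by rewrite lt_min mulr_gt0//= divr_gt0// exprn_gt0.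
  have [K1 HK1] := r_small d d0.
  have [N HN] : exists N : nat, eta^-1 < N%:R.
    by exists (Num.Def.truncn eta^-1).+1; rewrite truncnS_gt.
  have [j Jj Hj] := lP eta (J + K1 + N)%N eta0.
  have [Kk Fk] := kjP j.
  have Kk' : (K <= kj j)%N by apply: leq_trans Kk; exact: leq_addr.
  have jk : (j <= kj j)%N by apply: leq_trans Kk; exact: leq_addl.
  have := HK1 (kj j - K)%N; rewrite /r subnKC// => /(_ _)/wrap[].
    rewrite leq_subRL//; apply: leq_trans Kk; rewrite leq_add2l.
    by apply: leq_trans Jj; rewrite -addnA addnCA leq_addr.
  rewrite lt_min => /andP[rd1 rd2].
  have gk : 0 <= th * c * g (x (kj j)) by rewrite !mulr_ge0// ltW.
  have Dk := D0 (kj j).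
  exists (kj j); split => //.
  - by apply: leq_trans jk; apply: leq_trans Jj; rewrite -addnA leq_addr.
  - by rewrite -(ltr_pM2l thc); move: gk Dk rd1; lra.
  - apply: (lt_le_trans Fk); rewrite lerD2l invf_ple ?posrE ?ltr0n//.
    apply: (le_trans (ltW HN)); rewrite ler_nat; apply: leqW.
    by apply: leq_trans Jj; rewrite leq_addl.
  move=> i im.
  have -> : phi (kj j) i - l = (phi (kj j) i - x (kj j)) + (x (kj j) - l).
    by rewrite addrA subrK.
  apply: enormD_lt => //.
  rewrite -(ltr_pXn2r (_ : 0 < 2)%N)// ?nnegrE ?enorm_ge0 ?ltW// sqr_enorm.
  apply: (le_lt_trans (phi_drift Kk' im)); rewrite -/C mulrC -ltr_pdivlMr//.
have gl : g l = 0.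
  apply/le_anti; rewrite g0 andbT.
  have [M M0 HM] := convex_linear_lower_bound l n0 cg.
  apply: le_of_eps => eta eta0.
  have M1 : 0 < M + 1 by lra.
  pose d := eta / (M + 1).
  have d0 : 0 < d by rewrite divr_gt0.
  have dE : (M + 1) * d = eta by rewrite mulrC mulfVK// gt_eqF.
  have [k [_ xk gk _ _]] := near_l d 0%N d0.
  have := HM (x k); have := ler_wpM2l M0 (ltW xk); move: gk dE; lra.
have Fl : F l <= F u.
  (* The slopes are chosen per summand because each [f i + h i] is evaluated at its own point
     [phi k i.+1], within [2 * d] of [l]. *)
  have /choice[M HM] : forall i : nat, exists M : R, 0 <= M /\ ((i < m)%N ->
      forall y, f i l + h i l - M * enorm (y - l) <= f i y + h i y).
    move=> i; have [im|im] := boolP (i < m)%N; last by exists 0.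
    have [ch _] := hh im.
    have [M M0 HM] := convex_linear_lower_bound l n0 (convex_funD (cf im) ch).
    by exists M.
  pose T := \sum_(i < m) M i.
  have T0 : 0 <= T by apply: sumr_ge0 => i _; exact: (HM i).1.
  apply: le_of_eps => eta eta0.
  have T1 : 0 < 2 * T + 1 by lra.
  pose d := eta / (2 * T + 1).
  have d0 : 0 < d by rewrite divr_gt0.
  have dE : (2 * T + 1) * d = eta by rewrite mulrC mulfVK// gt_eqF.
  have [k [_ _ _ Fk phik]] := near_l d 0%N d0.
  have : F l - T * (2 * d) <= Fphi k.
    rewrite /F /T mulr_suml -sumrB; apply: ler_sum => i _.
    have [Mi0 /(_ (ltn_ord i) (phi k i.+1))] := HM i.
    apply: le_trans; rewrite lerD2l lerN2; apply: ler_wpM2l => //.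
    exact: ltW (phik _ (ltn_ord i)).
  move: Fk dE; lra.
have Sl : S l.
  split=> [|y gy]; first by apply/argmin0.
  by apply: (le_trans Fl); have [_] := Su; exact.
exists l; split => //.
(* The errors depend on the minimizer, so the quasi-Fejer inequality is taken anew at [l]. *)
have [e' [B' [e'0 e'B' step']]] := shift l Sl.
rewrite -(cvg_shiftn K); apply: enorm_cvg.
have -> : (fun k => dotv (x (k + K)%N - l) (x (k + K)%N - l)) = a l.
  by apply/funext => k; rewrite /a /dist addnC.
apply: (quasi_fejer_cvg0 (fun k => dist0 l _) r0 e'0 e'B' step') => eta J eta0.
have seta : 0 < Num.sqrt eta by rewrite sqrtr_gt0.
have [k [JK xk _ _ _]] := near_l _ (K + J)%N seta.
exists (k - K)%N; first by rewrite leq_subRL// (leq_trans _ JK)// leq_addr.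
rewrite /a subnKC ?(leq_trans _ JK) ?leq_addr// /dist.
by rewrite -(ltr_sqrt _ eta0).
Qed.

End Algorithm.

(** * Constants extracted from the hypotheses *)

Unset Implicit Arguments.

Theorem theorem2p1 (R : realType) (m n : nat)
  (f h : nat -> 'rV[R]_n -> R) (gradh : nat -> 'rV[R]_n -> 'rV[R]_n)
  (L : nat -> R) (g : 'rV[R]_n -> R) (gradg : 'rV[R]_n -> 'rV[R]_n) (Lg : R)
  (alpha beta : nat -> R) (x1 : 'rV[R]_n) :
  (1 <= m)%N -> (1 <= n)%N ->
  (forall i, (i < m)%N -> convex_fun (f i)) ->
  (forall i, (i < m)%N -> convex_fun (h i) /\ is_gradient (h i) (gradh i) /\
                          0 < L i /\ lipschitz_with (gradh i) (L i)) ->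
  convex_fun g -> is_gradient g gradg -> 0 < Lg -> lipschitz_with gradg Lg ->
  (* min g = 0 *)
  ((exists x, g x = 0) /\ forall x, 0 <= g x) ->
  (* S nonempty, S = argmin of F = sum (f_i + h_i) over argmin g *)
  let F := fun x => \sum_(i < m) (f i x + h i x) in
  let S := [set x | argmin g x /\ forall y, argmin g y -> F x <= F y] in
  S !=set0 ->
  (forall k, 0 < alpha k) -> (forall k, 0 < beta k) ->
  (* (H1) *)
  (forall x : 'rV[R]_n,
     subdiffE (fun y => ((\sum_(i < m) f i y)%:E + delta_set (argmin g) y)%E) x =
     [set v | exists (u : nat -> 'rV[R]_n) (p : 'rV[R]_n),
                (forall i, (i < m)%N -> subdiff (f i) x (u i)) /\
                normal_cone (argmin g) x p /\
                v = \sum_(i < m) u i + p]) ->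
  (* (H2) *)
  (\sum_(0 <= k <oo) (alpha k)%:E = +oo)%E ->
  (\sum_(0 <= k <oo) ((alpha k) ^+ 2)%:E < +oo)%E ->
  (* (H3) *)
  (0 < limn_einf (fun k => (alpha k * beta k)%:E))%E ->
  (limn_einf (fun k => (alpha k * beta k)%:E) <=
     limn_esup (fun k => (alpha k * beta k)%:E))%E ->
  (limn_esup (fun k => (alpha k * beta k)%:E) < (2 / Lg)%:E)%E ->
  (* (H4) *)
  (forall p, ran_normal_cone (argmin g) p ->
     (\sum_(0 <= k <oo) ((alpha k * beta k)%:E *
         (conjugate g ((beta k)^-1 *: p)
          - support_fun (argmin g) ((beta k)^-1 *: p))) < +oo)%E) ->
  exists xs, S xs /\
    (xseq m f h gradh gradg alpha beta x1 @ \oo --> xs).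
Proof.
move=> m0 n0 cf hh cg dg Lg0 gL [gz g0] F S Sne a0 b0 H1 adiv asq einf _ esup H4.
have [e [ee e0 [B eB]]] := nneseries_real (fun k => (sqr_ge0 (alpha k) : (0 <= _ %:E)%E)) asq.
have eE k : e k = alpha k ^+ 2 by apply/EFin_inj; rewrite ee.
have asqB N : \sum_(k < N) alpha k ^+ 2 <= B.
  by rewrite (le_trans _ (eB N))//; apply: ler_sum => k _; rewrite eE.
have [c c0 [K1 HK1]] := limn_einf_gt einf.
have [M ML [K2 HK2]] := limn_esup_lt esup.
(* A positive bound for all [L i]; eventually [alpha k < 1 / (2 T)], hence
   [alpha k * L i <= 1 / 2]. *)
pose T := 1 + \sum_(i < m) L i.
have L0 (i : nat) : (i < m)%N -> 0 < L i by move=> /hh[_ [_ []]].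
have LT (i : nat) : (i < m)%N -> L i <= T.
  move=> im; rewrite /T (bigD1 (Ordinal im))//= addrCA lerDl addr_ge0//.
  by apply: sumr_ge0 => j _; rewrite ltW// L0.
have T0 : 0 < T.
  by rewrite ltr_wpDr//; apply: sumr_ge0 => j _; rewrite ltW// L0.
have T2 : 0 < (2 * T)^-1 by rewrite invr_gt0 mulr_gt0.
have [K3 HK3] := bounded_sums_cvg0 (fun k => sqr_ge0 (alpha k)) asqB (exprn_gt0 2 T2).
pose K := (K1 + K2 + K3)%N.
have KK k : (K <= k)%N -> [/\ K1 <= k, K2 <= k & K3 <= k]%N.
  move=> Kk; split; apply: leq_trans Kk; rewrite /K ?leq_addl// -addnA ?leq_addr//.
  by rewrite addnCA leq_addr.
have cM : c <= M.
  have [h1 h2 _] := KK K (leqnn _).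
  exact: le_trans (HK1 _ h1) (HK2 _ h2).
have M0 : 0 < M := lt_le_trans c0 cM.
have ML2 : M * Lg < 2 by rewrite -ltr_pdivlMr.
have ML0 : 0 < M * Lg by rewrite mulr_gt0.
(* Then [M * Lg = 2 - 4 th], and [(1 + th) (2 - 4 th) <= 2 (1 - th)]. *)
pose th := (2 - M * Lg) / 4.
have th0 : 0 < th by rewrite divr_gt0//; lra.
have th1 : th <= 1 by rewrite /th; lra.
apply: (@xseq_cvg R m n f h gradh L g gradg Lg alpha beta x1 m0 n0 cf hh cg dg Lg0 gL gz g0
  a0 b0 H1 adiv (ex_intro _ B asqB) H4 K c th c0 th0 th1) => // k Kk; have [h1 h2 h3] := KK k Kk.
- exact: HK1.
- rewrite ler_pdivlMr// -mulrA.
  have sL : alpha k * beta k * Lg <= M * Lg by rewrite ler_pM2r// HK2.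
  apply: (@le_trans _ _ ((1 + th) * (M * Lg))); first by rewrite ler_pM2l//; lra.
  have : 0 <= th * (2 - M * Lg) by rewrite mulr_ge0 ?(ltW th0)// subr_ge0 ltW.
  have : M * Lg = 2 - 4 * th by rewrite /th; field.
  move=> -> ; lra.
move=> i im; have := HK3 k h3.
rewrite ltr_pXn2r// ?nnegrE ?(ltW T2) ?(ltW (a0 k))// => ak.
apply: (@le_trans _ _ ((2 * T)^-1 * T)); last by rewrite invfM mulfVK ?gt_eqF// div1r.
by apply: ler_pM; [exact: ltW|exact: ltW (L0 i im)|exact: ltW|exact: LT].
Qed.
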